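(* Let $n$ and $k$ be positive integers such that $n\ge4k$. Then \[{\rm ot}(n,K_{1,k})=\begin{cases}\left\lfloor\left(\frac{k-1}{2}\right)n\right\rfloor, & \text{for } k\le3,\\[1ex] (k-2)n-\frac{k^2}{2}+\frac32k-1, & \text{for } k\ge4,\end{cases}\] and ${\rm Ot}(n,K_{1,k})$ is the family of ($n$-vertex) graphs consisting of: (1) the empty graph $\overline{K_n}$, if $k=1$; (2) the disjoint union of $\frac n2$ copies of $K_2$ when $n$ is even, and of $\frac{n-1}{2}$ copies of $K_2$ and one $K_1$ when $n$ is odd, if $k=2$; (3) the disjoint unions of cycles (covering all $n$ vertices), if $k=3$; (4) the complete $(k-2,\,n-k+2)$-split graph, if $k\ge4$.
   Context: $K_{1,k}$ is the star with $k$ edges. A complete $(p,q)$-split graph is a graph whose vertex set has a partition $X\cup Y$ with $|X|=p$, $|Y|=q$, $X$ inducing a complete graph $K_p$, $Y$ independent, and all edges between $X$ and $Y$ present. A $2$-coloring $E(K_n)=E(R)\cup E(B)$ is a partition of the edges of $K_n$ into red and blue edges, forming the spanning subgraphs $R$ and $B$; $e(\cdot)$ denotes number of edges. An $(r,b)$-colored copy of a graph $G$ (with $r+b=e(G)$) is a (not necessarily induced) subgraph of $K_n$ isomorphic to $G$ with exactly $r$ red and $b$ blue edges. ${\rm ot}(n,G)$ is the minimum non-negative integer $s$ such that every $2$-coloring $E(K_n)=E(R)\cup E(B)$ with $\min\{e(R),e(B)\}>s$ contains an $(r,b)$-colored copy of $G$ for every pair of integers $r,b\ge0$ with $r+b=e(G)$.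 ${\rm Ot}(n,G)$ is the family (up to isomorphism) of $n$-vertex graphs with exactly ${\rm ot}(n,G)$ edges such that a coloring $E(K_n)=E(R)\cup E(B)$ with $\min\{e(R),e(B)\}={\rm ot}(n,G)$ contains no $(r,b)$-colored copy of $G$ for some pair $r,b\ge0$ with $r+b=e(G)$ if and only if $R$ or $B$ is isomorphic to some $H\in{\rm Ot}(n,G)$. *)

(* Defs.v *)
From HB Require Import structures.
From mathcomp Require Import all_boot all_order all_algebra.
From mathcomp Require Import boolp.

Set Implicit Arguments.
Unset Strict Implicit.
Unset Printing Implicit Defensive.

Record sgraph (V : finType) := SGraph {
  edges : {set {set V}};
  edges_card2 : [forall e in edges, #|e| == 2] }.

Definition adj (V : finType) (G : sgraph V) (x y : V) : bool :=
  [set x; y] \in edges G.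

Lemma rel_edges_card2 (V : finType) (a : rel V) :
  [forall e in [set [set x; y] | x in V, y in V & (x != y) && a x y], #|e| == 2].
Proof.
apply/forall_inP => e /imset2P[x y _]; rewrite inE => /and3P[_ xy _] ->.
by rewrite cards2 xy.
Qed.

(* [a] need not be symmetric or irreflexive: xy is an edge iff x and y are
   distinct and [a] relates them in at least one direction. *)
Definition graph_of_rel (V : finType) (a : rel V) : sgraph V :=
  SGraph (rel_edges_card2 a).

Definition iso (V W : finType) (G : sgraph V) (H : sgraph W) : Prop :=
  exists f : V -> W, bijective f /\ forall x y, adj G x y = adj H (f x) (f y).

Definition empty_graph (n : nat) : sgraph 'I_n :=
  graph_of_rel (fun _ _ => false).

Definition complete_graph (n : nat) : sgraph 'I_n :=
  graph_of_rel (fun _ _ => true).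

Definition star (k : nat) : sgraph 'I_k.+1 :=
  graph_of_rel (fun x y => (x == ord0) && (y != ord0)).

(* [ordS] is the cyclic successor; this is the cycle C_m only for m >= 3. *)
Definition cycle_graph (m : nat) : sgraph 'I_m :=
  graph_of_rel (fun x y => y == ordS x).

(* The disjoint union of the graphs [G m], for [m] in [s] with multiplicity;
   the vertex [Tagged _ v] with tag [i] is the vertex [v] of the i-th graph. *)
Definition disjoint_union (G : forall m, sgraph 'I_m) (s : seq nat) :
    sgraph {i : 'I_(size s) & 'I_(nth 0 s i)} :=
  graph_of_rel (fun u v =>
    [exists i : 'I_(size s), exists x : 'I_(nth 0 s i),
     exists y : 'I_(nth 0 s i),
       [&& u == Tagged (fun i : 'I_(size s) => 'I_(nth 0 s i)) x,
           v == Tagged (fun i : 'I_(size s) => 'I_(nth 0 s i)) y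
         & adj (G (nth 0 s i)) x y]]).

Definition complete_split (p q : nat) (V : finType) (G : sgraph V) : Prop :=
  exists X Y : {set V},
    [/\ X :|: Y = [set: V] /\ [disjoint X & Y],
        #|X| = p /\ #|Y| = q,
        {in X &, forall x y, x != y -> adj G x y},
        {in Y &, forall x y, ~~ adj G x y}
      & {in X & Y, forall x y, adj G x y}].

Definition two_coloring (n : nat) (R B : sgraph 'I_n) : Prop :=
  edges R :|: edges B = edges (complete_graph n) /\
  [disjoint edges R & edges B].

(* A copy of [G] in K_n is the image of [G] under an injection [f] of its
   vertices into those of K_n. *)
Definition colored_copy (V : finType) (G : sgraph V) (n : nat)
    (R B : sgraph 'I_n) (r b : nat) : Prop :=
  exists f : V -> 'I_n,
    [/\ injective f,
        #|[set f @: (e : {set V}) | e in edges G] :&: edges R| = r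
      & #|[set f @: (e : {set V}) | e in edges G] :&: edges B| = b].

Definition omnitonal_above (n : nat) (V : finType) (G : sgraph V) (s : nat) :
    Prop :=
  forall R B : sgraph 'I_n, two_coloring R B ->
    s < minn #|edges R| #|edges B| ->
    forall r b : nat, r + b = #|edges G| -> colored_copy G R B r b.

Lemma omnitonal_above_ex (n : nat) (V : finType) (G : sgraph V) :
  exists s, `[< omnitonal_above n G s >].
Proof.
exists #|{set 'I_n}|; apply/asboolP => R B _.
by rewrite ltnNge geq_min max_card.
Qed.

Definition ot (n : nat) (V : finType) (G : sgraph V) : nat :=
  ex_minn (omnitonal_above_ex n G).

(* Ot(n,G), a family of n-vertex graphs up to isomorphism, is represented by an
   isomorphism-closed class of graphs on ['I_n]. *)
Definition is_Ot (n : nat) (V : finType) (G : sgraph V)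
    (F : sgraph 'I_n -> Prop) : Prop :=
  [/\ forall H H' : sgraph 'I_n, iso H H' -> F H -> F H',
      forall H : sgraph 'I_n, F H -> #|edges H| = ot n G
    & forall R B : sgraph 'I_n, two_coloring R B ->
        minn #|edges R| #|edges B| = ot n G ->
        ((exists r b : nat, r + b = #|edges G| /\ ~ colored_copy G R B r b) <->
         (exists H : sgraph 'I_n, F H /\ (iso R H \/ iso B H)))].

(* Main.v *)
(* A copy of K_{1,k} with r red and b blue edges exists iff some vertex has red
   degree at least r and blue degree at least b.  If there is none, the vertices
   split into X (blue degree < b) and Y (red degree < r); by symmetry |X| <= |Y|.
   Counting the pairs in X x Y gives |X||Y| <= |X|(b-1) + |Y|(r-1), which for
   n >= 4k forces b = 0, so that X is empty, or |X| <= k-2.  In the latter case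
   2 e(R) <= |X|(n-1) + (n-|X|)(r-1) is maximal exactly for |X| = r-1 = k-2, and
   equality makes R a complete split graph.  If b = 0, all red degrees are at
   most k-1, so e(R) <= (k-1)n/2.  The split bound is the larger of the two
   exactly when k >= 4; for k <= 3 the extremal graphs are those of maximum
   degree at most k-1 with floor((k-1)n/2) edges. *)

Require Import Defs.
From HB Require Import structures.
From mathcomp Require Import all_boot all_order all_algebra.
From mathcomp Require Import boolp.
From mathcomp Require Import zify lra.

Set Implicit Arguments.
Unset Strict Implicit.
Unset Printing Implicit Defensive.

Import Order.TTheory GRing.Theory Num.Theory.

(** * Degrees and isomorphisms *)

Definition deg (V : finType) (G : sgraph V) (x : V) : nat := #|adj G x|.

Lemma set2C (T : finType) (x y : T) : [set x; y] = [set y; x].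
Proof. by rewrite setUC. Qed.

(** Lets edges at a fixed vertex be counted by their other ends. The degenerate pair with [y = x] is
    covered, so no distinctness hypothesis has to be carried along. *)
Lemma set2_inj (T : finType) (x : T) : injective (fun y => [set x; y]).
Proof.
move=> y z /setP eq_yz; have := eq_yz y; have := eq_yz z; 
rewrite !inE !eqxx !orbT.
by case: (eqVneq y x) => [->|_ _ /esym/eqP//]; rewrite orbb => /eqP.
Qed.

Lemma eq_set2 (T : finType) (x y a b : T) :
  [set x; y] = [set a; b] -> x = a /\ y = b \/ x = b /\ y = a.
Proof.
move=> eq_e; have: x \in [set a; b] by rewrite -eq_e set21.
case/set2P=> eq_x; [left|right]; split=> //; move: eq_e; rewrite eq_x.
- exact: set2_inj.
- by rewrite [RHS]set2C; apply: set2_inj.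
Qed.

Section Graphs.
Variables (V : finType) (G : sgraph V).
Implicit Types x y : V.

Lemma adjC x y : adj G x y = adj G y x.
Proof. by rewrite /adj set2C. Qed.

Lemma edgesP (e : {set V}) :
  reflect (exists x y, [/\ x != y, adj G x y & e = [set x; y]]) (e \in edges G).
Proof.
apply: (iffP idP); last by case=> x [y [_ xy ->]].
move=> eG.
have /forall_inP/(_ e eG)/cards2P[x [y [neq_xy eE]]] := edges_card2 G.
by exists x, y; split; rewrite // /adj -eE.
Qed.

Lemma adj_neq x y : adj G x y -> x != y.
Proof.
move=> xy; have /forall_inP/(_ _ xy) := edges_card2 G.
by rewrite cards2; case: (x != y).
Qed.

Lemma in_adj x y : (y \in adj G x) = adj G x y.
Proof. by []. Qed.

Lemma adjxx x : adj G x x = false.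
Proof. by apply/negP => /adj_neq; rewrite eqxx. Qed.

Lemma degE x : deg G x = \sum_y adj G x y.
Proof. by rewrite /deg -sum1_card big_mkcond. Qed.

(* Count the pairs (x, e) with x an endpoint of the edge e in two ways. *)
Lemma handshake : \sum_x deg G x = 2 * #|edges G|.
Proof.
have degI x : deg G x = \sum_(e in edges G) (x \in e).
  rewrite -big_mkcondr /= sum1_card /deg -(card_imset _ (@set2_inj V x)).
  apply: eq_card => e; apply/imsetP/idP => [[y xy ->]|].
    by rewrite -topredE /= set21 andbT; apply: xy.
  rewrite -topredE /= => /andP[/edgesP[a [b [_ ab ->]]]].
  case/set2P=> ->; first by exists b.
  by exists a; rewrite 1?set2C // in_adj adjC.
under eq_bigr do rewrite degI.
rewrite exchange_big /= mulnC -sum_nat_const; apply: eq_bigr => e eG.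
rewrite -big_mkcond /= sum1_card.
by have /forall_inP/(_ e eG)/eqP := edges_card2 G.
Qed.

End Graphs.

Lemma adj_graph_of_rel (V : finType) (a : rel V) (x y : V) :
  adj (graph_of_rel a) x y = (x != y) && (a x y || a y x).
Proof.
apply/imset2P/andP => [[u v _]|[neq_xy /orP[axy|ayx]]].
- rewrite inE => /andP[_ /andP[neq_uv auv]].
  by case/eq_set2=> -[-> ->]; rewrite ?auv ?orbT // eq_sym.
- by exists x y; rewrite // inE neq_xy axy.
- by exists y x; rewrite // ?inE 1?eq_sym ?neq_xy ?ayx //= set2C.
Qed.

Lemma iso_sym (V W : finType) (G : sgraph V) (H : sgraph W) :
  iso G H -> iso H G.
Proof.
case=> f [[g fK gK] adjf]; exists g; split; first by exists f.
by move=> x y; rewrite adjf !gK.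
Qed.

Lemma iso_trans (U V W : finType) (F : sgraph U) (G : sgraph V) (H : sgraph W) :
  iso F G -> iso G H -> iso F H.
Proof.
case=> f [bij_f adjf] [g [bij_g adjg]]; exists (g \o f).
by split; [apply: bij_comp | move=> x y; rewrite adjf adjg].
Qed.

Lemma iso_deg (V W : finType) (G : sgraph V) (H : sgraph W) (f : V -> W) :
  bijective f -> (forall x y, adj G x y = adj H (f x) (f y)) ->
  forall x, deg G x = deg H (f x).
Proof.
move=> bij_f adjf x; rewrite /deg -(on_card_preimset (onW_bij _ bij_f)).
by apply: eq_card => y; rewrite !inE -!topredE /= adjf.
Qed.

Lemma iso_edges (V W : finType) (G : sgraph V) (H : sgraph W) :
  iso G H -> #|edges G| = #|edges H|.
Proof.
case=> f [bij_f adjf]; apply/eqP; rewrite -(eqn_pmul2l (ltn0Sn 1)) -!handshake.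
rewrite (reindex f) /=; last exact: onW_bij.
by apply/eqP/eq_bigr => x _; apply: iso_deg.
Qed.

(** Brings graphs built on other vertex types, such as the sigma type of [disjoint_union], to
    ['I_n], where the members of [is_Ot] live. *)
Lemma iso_ord (V : finType) (G : sgraph V) (n : nat) :
  #|V| = n -> exists H : sgraph 'I_n, iso H G.
Proof.
move=> cardV.
exists (graph_of_rel (fun i j => adj G (enum_val (cast_ord (esym cardV) i))
                                       (enum_val (cast_ord (esym cardV) j)))).
exists (enum_val \o cast_ord (esym cardV)); split.
  apply: bij_comp; first exact: enum_val_bij.
  by exists (cast_ord cardV); [apply: cast_ordKV | apply: cast_ordK].
move=> i j; rewrite adj_graph_of_rel [adj _ _ _ || _]orbC -adjC orbb /=.
by case: (eqVneq i j) => [->|//]; rewrite adjxx.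
Qed.

(** * Colourings and stars *)

Lemma adj_coloring (n : nat) (R B : sgraph 'I_n) : two_coloring R B ->
  forall x y, x != y -> adj B x y = ~~ adj R x y.
Proof.
case=> /setP RB disj x y neq_xy; have := RB [set x; y].
have := adj_graph_of_rel (fun _ _ : 'I_n => true) x y.
rewrite /adj inE neq_xy => ->.
case: (boolP ([set x; y] \in edges R)) => [eR _|_ /= ->//].
by apply/negbTE; rewrite (disjointFr disj).
Qed.

Lemma coloringP (n : nat) (R B : sgraph 'I_n) :
  (forall x y, x != y -> adj B x y = ~~ adj R x y) -> two_coloring R B.
Proof.
move=> RB; split.
  apply/setP => e; rewrite inE; apply/orP/edgesP.
    move=> eRB; suff: exists x y : 'I_n, x != y /\ e = [set x; y].
      case=> x [y [neq_xy ->]]; exists x, y.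
      by split; rewrite ?adj_graph_of_rel ?neq_xy.
    by case: eRB => /edgesP[x [y [neq_xy _ ->]]]; exists x, y.
  case=> x [y [neq_xy _ ->]]; rewrite -/(adj R x y) -/(adj B x y) RB //.
  by case: adj; [left|right].
rewrite -setI_eq0; apply/eqP/setP => e; rewrite !inE; apply/negP => /andP[eR].
case/edgesP=> x [y [neq_xy xyB eE]]; move: xyB.
by rewrite RB // /adj -eE eR.
Qed.

Lemma coloring_sym (n : nat) (R B : sgraph 'I_n) :
  two_coloring R B -> two_coloring B R.
Proof. by case=> RB disj; split; rewrite 1?setUC // disjoint_sym. Qed.

(** Makes every graph a colour class, so that degree identities for colourings apply to a single
    graph. *)
Lemma coloring_compl (n : nat) (R : sgraph 'I_n) :
  two_coloring R (graph_of_rel (fun x y => ~~ adj R x y)).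
Proof.
apply: coloringP => x y neq_xy.
by rewrite adj_graph_of_rel neq_xy (adjC R y) orbb.
Qed.

Lemma deg_coloring (n : nat) (R B : sgraph 'I_n) : two_coloring R B ->
  forall x, deg R x + deg B x = n.-1.
Proof.
move=> RB x; rewrite !degE -big_split /= (bigD1 x) //= !adjxx add0n.
rewrite (eq_bigr (fun _ => 1)) => [|y]; last first.
  by rewrite eq_sym => /(adj_coloring RB)->; case: adj.
rewrite sum1_card; have := cardC1 x; rewrite card_ord => <-.
exact: eq_card.
Qed.

Lemma edges_coloring (n : nat) (R B : sgraph 'I_n) : two_coloring R B ->
  2 * (#|edges R| + #|edges B|) = n * n.-1.
Proof.
move=> RB; rewrite mulnDr -!handshake -big_split /=.
under eq_bigr do rewrite (deg_coloring RB).
by rewrite sum_nat_const card_ord.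
Qed.

Lemma deg_complete (m : nat) (x : 'I_m) : deg (complete_graph m) x = m.-1.
Proof.
rewrite -(deg_coloring (coloring_compl (complete_graph m)) x).
rewrite -[LHS]addn0; congr (_ + _); apply/esym/eq_card0 => y.
rewrite in_adj adj_graph_of_rel (adjC _ y) orbb adj_graph_of_rel andbT.
by rewrite andbN inE.
Qed.

Lemma colored_copyC (V : finType) (G : sgraph V) (n : nat) (R B : sgraph 'I_n)
    (r b : nat) :
  colored_copy G R B r b -> colored_copy G B R b r.
Proof. by case=> f [inj_f cR cB]; exists f. Qed.

Lemma adj_star (k : nat) (x y : 'I_k.+1) :
  adj (star k) x y = (x != y) && ((x == ord0) || (y == ord0)).
Proof.
rewrite adj_graph_of_rel; case: (eqVneq x y) => //= neq_xy.
by case: (eqVneq x ord0) neq_xy => [->|_] neq_xy; rewrite ?andbT 1?eq_sym ?neq_xy.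
Qed.

Lemma edges_star (k : nat) :
  edges (star k) = [set [set ord0; lift ord0 j] | j : 'I_k].
Proof.
apply/setP => e; apply/edgesP/imsetP; last first.
  by case=> j _ ->; exists ord0, (lift ord0 j); split; rewrite ?adj_star ?eqxx.
case=> x [y []]; rewrite adj_star => neq_xy /andP[_ /orP[]/eqP x0] ->.
  by case: (unliftP x y) neq_xy => [j ->|->]; rewrite ?eqxx // x0 => _; exists j.
case: (unliftP y x) neq_xy => [j ->|->]; rewrite ?eqxx // x0 => _.
by exists j; rewrite // set2C.
Qed.

Lemma card_edges_star (k : nat) : #|edges (star k)| = k.
Proof.
by rewrite edges_star card_imset ?card_ord // => i j /set2_inj /lift_inj.
Qed.

(** All edges of the copy share the centre [f ord0], so counting edges of one colour amounts to
    counting leaves in a neighbourhood of the centre. *)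
Lemma colored_star_card (n k : nat) (H : sgraph 'I_n) (f : 'I_k.+1 -> 'I_n) :
  #|[set f @: (e : {set 'I_k.+1}) | e in edges (star k)] :&: edges H| =
  #|[set f (lift ord0 j) | j : 'I_k] :&: [set w | adj H (f ord0) w]|.
Proof.
rewrite -(card_imset _ (@set2_inj _ (f ord0))) edges_star.
apply: eq_card => e; rewrite inE; apply/andP/imsetP.
  case=> /imsetP[_ /imsetP[j _ ->] ->]; rewrite imsetU1 imset_set1 => eH.
  by exists (f (lift ord0 j)); rewrite // !inE imset_f.
case=> w; rewrite !inE => /andP[/imsetP[j _ ->] adj_w] ->; split=> //.
apply/imsetP; exists [set ord0; lift ord0 j].
  by apply/imsetP; exists j.
by rewrite imsetU1 imset_set1.
Qed.

(** Red and blue neighbourhoods of a vertex are disjoint, so [r] red and [b] blue neighbours can be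
    chosen independently as the leaves. *)
Lemma colored_starP (n r b : nat) (R B : sgraph 'I_n) : two_coloring R B ->
  colored_copy (star (r + b)) R B r b <->
  exists v, r <= deg R v /\ b <= deg B v.
Proof.
move=> RB; split=> [[f [_]]|[v []]].
  rewrite !colored_star_card => cR cB; exists (f ord0).
  split; [rewrite -[X in X <= _]cR | rewrite -[X in X <= _]cB];
  by apply/subset_leq_card/subsetP => w; rewrite !inE => /andP[].
rewrite /deg => /card_geqP[s [s_uniq s_size s_sub]].
move=> /card_geqP[t [t_uniq t_size t_sub]].
have sR w (ws : w \in s) : adj R v w := s_sub w ws.
have tB w (wt : w \in t) : adj B v w := t_sub w wt.
have disjRB w : adj R v w -> adj B v w -> False.
  by move=> vwR; rewrite (adj_coloring RB) ?vwR ?(adj_neq vwR).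
have uniq_st : uniq (s ++ t).
  rewrite cat_uniq s_uniq t_uniq andbT; apply/hasPn => w /tB wB.
  by apply/negP => /sR wR; apply: disjRB wR wB.
have size_st : size (s ++ t) = r + b by rewrite size_cat s_size t_size.
have v_st : v \notin s ++ t.
  by rewrite mem_cat; apply/negP => /orP[/sR|/tB]; rewrite adjxx.
(* Position 0 is the centre, then come the red and the blue leaves. All indices are in range, so the
   default [v] is never returned. *)
pose f (i : 'I_(r + b).+1) := nth v (v :: s ++ t) i.
have inj_f : injective f.
  move=> i j /eqP; rewrite nth_uniq /= ?size_st ?v_st //.
  by move/eqP/val_inj.
have imf : [set f (lift ord0 j) | j : 'I_(r + b)] = [set w in s ++ t].
  apply/setP => w; rewrite inE; apply/imsetP/idP => [[j _ ->]|w_st].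
    by rewrite /f /= mem_nth // size_st; apply: ltn_ord.
  have wi : index w (s ++ t) < r + b by rewrite -size_st index_mem.
  by exists (Ordinal wi); rewrite // /f /= nth_index.
exists f; rewrite !colored_star_card imf; split=> //.
  rewrite -[RHS]s_size -(card_uniqP s_uniq); apply: eq_card => w.
  rewrite !inE mem_cat /f /=; apply/andP/idP => [[/orP[//|wt] vwR]|ws].
    by case: (disjRB w vwR (tB w wt)).
  by rewrite ws sR.
rewrite -[RHS]t_size -(card_uniqP t_uniq); apply: eq_card => w.
rewrite !inE mem_cat /f /=; apply/andP/idP => [[/orP[ws|//] vwB]|wt].
  by case: (disjRB w (sR w ws) vwB).
by rewrite wt orbT tB.
Qed.

(** * The extremal bound *)

(* Every pair of X x ~: X is blue at its end in X or red at its end in ~: X. *)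
Lemma cross_count (n r b : nat) (R B : sgraph 'I_n) (X : {set 'I_n}) :
  two_coloring R B ->
  {in X, forall x, deg B x <= b} -> {in ~: X, forall y, deg R y <= r} ->
  #|X| * #|~: X| <= #|X| * b + #|~: X| * r.
Proof.
move=> RB degB degR.
have -> : #|X| * #|~: X| =
    \sum_(x in X) \sum_(y in ~: X) adj B x y +
    \sum_(y in ~: X) \sum_(x in X) adj R y x.
  rewrite [X in _ + X]exchange_big /= -big_split /= -sum_nat_const.
  apply: eq_bigr => x xX; rewrite -big_split /= -sum1_card.
  apply: eq_bigr => y; rewrite inE => yX.
  have neq_xy : x != y by apply: contraNneq yX => <-.
  by rewrite (adj_coloring RB neq_xy) (adjC R y); case: adj.
have deg_part (G : sgraph 'I_n) (A : {set 'I_n}) x :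
    \sum_(y in A) adj G x y <= deg G x.
  by rewrite degE [leqRHS](bigID (mem A)) /= leq_addr.
rewrite -!sum_nat_const; apply: leq_add; apply: leq_sum => x xX.
  exact: leq_trans (deg_part _ _ _) (degB x xX).
exact: leq_trans (deg_part _ _ _) (degR x xX).
Qed.

Lemma deg_le (n : nat) (G : sgraph 'I_n) (x : 'I_n) : deg G x <= n.-1.
Proof. by rewrite -(deg_coloring (coloring_compl G) x) leq_addr. Qed.

(* The defect of the degree bound with |X| = x and red degree r off X,
   relative to its maximum at x = r = j, as a sum of nonnegative terms. *)
Lemma split_edges_id (n j x r : nat) : j < n -> x <= j -> r <= j ->
  x * n.-1 + (n - x) * r + (n - x) * (j - r) + (j - x) * (n.-1 - j) =
  j * (2 * n - j - 1).
Proof.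
move=> jn xj rj; rewrite -(addnA (x * _) (_ * r)) -mulnDr subnKC //.
have [m ->] : exists m, n = j + m.+1 by exists (n - j.+1); lia.
have [u jE] : exists u, j = x + u by exists (j - x); lia.
have -> : j + m.+1 - x = u + m.+1 by lia.
have -> : j - x = u by lia.
have -> : (j + m.+1).-1 - j = m by lia.
have -> : (j + m.+1).-1 = j + m by lia.
have -> : 2 * (j + m.+1) - j - 1 = j + 2 * m + 1 by lia.
by rewrite jE; nia.
Qed.

(** The handshake sum under two degree caps. The [leqif] form keeps the equality case, all caps
    attained, from which the structure of extremal graphs is read off. *)
Lemma sum_deg_leqif (n p q : nat) (G : sgraph 'I_n) (X : {set 'I_n}) :
  {in X, forall x, deg G x <= p} -> {in ~: X, forall y, deg G y <= q} ->
  2 * #|edges G| <= #|X| * p + #|~: X| * q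
    ?= iff [forall x, deg G x == if x \in X then p else q].
Proof.
move=> degX degY; rewrite -handshake -!sum_nat_const.
have -> : \sum_(x in X) p + \sum_(x in ~: X) q =
    \sum_x (if x \in X then p else q).
  rewrite [RHS](bigID (mem X)) /=; congr (_ + _).
    by apply: eq_bigr => x ->.
  by apply: eq_big => [x|x]; rewrite inE // => /negbTE->.
apply: leqif_sum => x _; split=> //.
by case: ifPn => [/degX|xX]; last apply: degY; rewrite ?inE.
Qed.

(** The count of cross pairs rearranges to [(#|X| - (r - 1)) * (#|~: X| - (b - 1)) <= (r - 1) * (b -
    1)]. If [#|X|] were at least [r + b - 1], so would be [#|~: X|], and the left factors would be
    at least [b] and [r]. *)
Lemma low_blue_card_le (n r b : nat) (R B : sgraph 'I_n) (X : {set 'I_n}) :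
  two_coloring R B -> 4 * (r + b) <= n -> 0 < b -> #|X| <= #|~: X| ->
  {in X, forall x, deg B x < b} -> {in ~: X, forall y, deg R y < r} ->
  0 < r /\ #|X| <= r + b - 2.
Proof.
move=> RB le_n b_gt0 le_XY degB degR.
have cardXY : #|X| + #|~: X| = n by rewrite cardsC card_ord.
have r_gt0 : 0 < r.
  have /card_gt0P[y yY] : 0 < #|~: X| by lia.
  by have := degR y yY; lia.
(* From here on [r] and [b] stand for the predecessors of the original values. *)
split=> //; case: r r_gt0 le_n degR => // r _ le_n degR.
case: b b_gt0 le_n degB => // b _ le_n degB.
have count := cross_count RB degB degR; rewrite leqNgt; apply/negP => ltX.
have leX : b + 1 <= #|X| - r by lia.
have leY : r + 1 <= #|~: X| - b by lia.
have := leq_mul leX leY; move: count; rewrite mulnBl !mulnBr; nia.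
Qed.

(** Red degrees are capped by [n.-1] on [X] and by [r.-1] off it; [split_edges_id] with [j = k - 2]
    evaluates the resulting sum. Equality makes both defect terms vanish and all caps attained. *)
Lemma split_extremal (n k r b : nat) (R B : sgraph 'I_n) (X : {set 'I_n}) :
  two_coloring R B -> r + b = k -> 4 * k <= n -> 0 < b -> #|X| <= #|~: X| ->
  {in X, forall x, deg B x < b} -> {in ~: X, forall y, deg R y < r} ->
  [/\ 2 <= k, 2 * #|edges R| <= (k - 2) * (2 * n - k + 1)
    & 2 * #|edges R| = (k - 2) * (2 * n - k + 1) ->
      complete_split (k - 2) (n - k + 2) R].
Proof.
move=> RB rbk le_n b_gt0 le_XY degB degR.
have [r_gt0] : 0 < r /\ #|X| <= r + b - 2.
  by apply: low_blue_card_le RB _ b_gt0 le_XY degB degR; rewrite rbk.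
rewrite rbk => leX.
have cardXY : #|X| + #|~: X| = n by rewrite cardsC card_ord.
have le_r : r.-1 <= k - 2 by lia.
have k_ge2 : 1 < k by lia.
have degR' : {in ~: X, forall y, deg R y <= r.-1} by move=> y /degR; lia.
have leqif_e := sum_deg_leqif (fun x (_ : x \in X) => deg_le R x) degR'.
have lt_n : k - 2 < n by lia.
have sum_id := split_edges_id lt_n leX le_r.
have YE : #|~: X| = n - #|X| by lia.
have TE : 2 * n - (k - 2) - 1 = 2 * n - k + 1 by lia.
rewrite TE in sum_id; rewrite YE in leqif_e; split=> //.
  by apply: leq_trans (leqif_e.1) _; rewrite -sum_id -addnA leq_addr.
move=> eq_e; have := leqif_e.1.
rewrite eq_e -sum_id -addnA -[leqRHS]addn0 leq_add2l leqn0.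
rewrite addn_eq0 !muln_eq0 => /andP[zr zx].
(* The cofactors [n - #|X|] and [n.-1 - (k - 2)] are positive, so the other factor of each defect is
   zero. *)
have {zr} rE : r.-1 = k - 2 by lia.
have {zx} xE : #|X| = k - 2 by lia.
have /forallP deg_eq : [forall x, deg R x == if x \in X then n.-1 else r.-1].
  by rewrite -leqif_e.2 eq_e -sum_id rE xE !subnn muln0 mul0n !addn0.
have adjX x y : x \in X -> x != y -> adj R x y.
  move=> xX neq_xy; have := deg_coloring RB x; have /eqP := deg_eq x.
  rewrite xX => ->; rewrite -[RHS]addn0 => /addnI /card0_eq /(_ y).
  by rewrite in_adj (adj_coloring RB) // => /negbFE.
exists X, (~: X); split.
- by split; [rewrite setUCr | rewrite -subsets_disjoint].
- by split=> //; rewrite YE xE; lia.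
- by move=> x y xX _; apply: adjX.
(* A red edge from [y] to [z] off [X] would give [y] at least [#|X| + 1] red neighbours, but its red
   degree is [#|X|]. *)
- move=> y z; rewrite !inE => yX zX; apply/negP => yz.
  have /eqP := deg_eq y; rewrite (negbTE yX) rE -xE => degy.
  have : [set z] :|: X \subset adj R y.
    apply/subsetP => w; rewrite in_adj in_setU1 => /orP[/eqP->//|wX].
    by rewrite adjC adjX //; apply: contraNneq yX => <-.
  by move/subset_leq_card; rewrite -/(deg R y) degy cardsU1 zX ltnn.
- move=> x y xX; rewrite inE => yX; apply: (adjX x y xX).
  by apply: contraNneq yX => <-.
Qed.

(** * Disjoint unions of cliques and of cycles *)

Section DisjointUnion.
Variables (G : forall m, sgraph 'I_m) (s : seq nat).
Let T (i : 'I_(size s)) : finType := 'I_(nth 0 s i).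

Lemma adj_disjoint_union (i : 'I_(size s)) (x y : 'I_(nth 0 s i)) :
  adj (disjoint_union G s) (Tagged T x) (Tagged T y) = adj (G _) x y.
Proof.
rewrite adj_graph_of_rel.
have adj_tag (x' y' : 'I_(nth 0 s i)) :
    [exists i0 : 'I_(size s), exists x0 : 'I_(nth 0 s i0),
     exists y0 : 'I_(nth 0 s i0),
       [&& Tagged T x' == Tagged T x0, Tagged T y' == Tagged T y0
         & adj (G (nth 0 s i0)) x0 y0]] = adj (G _) x' y'.
  apply/existsP/idP => [[j /existsP[x0 /existsP[y0]]]|xy].
    case/and3P=> /eqP eq_x /eqP eq_y.
    have ij : i = j by apply: (congr1 tag eq_x).
    by case: j / ij x0 y0 eq_x eq_y => x0 y0 /eqP + /eqP; rewrite !eq_Tagged /=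
      => /eqP-> /eqP->.
  by exists i; apply/existsP; exists x'; apply/existsP; exists y'; rewrite !eqxx.
rewrite !adj_tag (adjC _ y x) orbb eq_Tagged /=.
by case: (eqVneq x y) => // ->; rewrite adjxx.
Qed.

Lemma adj_disjoint_union_tag (u v : {i : 'I_(size s) & 'I_(nth 0 s i)}) :
  adj (disjoint_union G s) u v -> tag u = tag v.
Proof.
rewrite adj_graph_of_rel => /andP[_ /orP[]] /existsP[i /existsP[x /existsP[y]]];
by case/and3P=> /eqP-> /eqP->.
Qed.

Lemma deg_disjoint_union (u : {i : 'I_(size s) & 'I_(nth 0 s i)}) :
  deg (disjoint_union G s) u = deg (G _) (tagged u).
Proof.
case: u => i x /=; rewrite /deg.
have inj_tag : injective (fun y : 'I_(nth 0 s i) => Tagged T y).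
  by move=> y z /eqP; rewrite eq_Tagged => /eqP.
rewrite -(card_image inj_tag); apply: eq_card => v; apply/idP/imageP => [xv|].
  case: v xv => j y xv; have ij : i = j := adj_disjoint_union_tag xv.
  case: j / ij y xv => y xv; exists y => //.
  by rewrite in_adj -adj_disjoint_union.
by case=> y xy ->; rewrite -topredE /= adj_disjoint_union.
Qed.

Lemma edges_disjoint_union (d : nat -> nat) :
  (forall m (x : 'I_m), deg (G m) x = d m) ->
  2 * #|edges (disjoint_union G s)| = \sum_(m <- s) m * d m.
Proof.
move=> degG; rewrite -handshake.
under eq_bigr do rewrite deg_disjoint_union degG.
rewrite -(sig_big_dep xpredT (fun _ => xpredT)
  (fun (i : 'I_(size s)) (_ : T i) => d (nth 0 s i))) /=.
under eq_bigr do rewrite sum_nat_const card_ord.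
by rewrite (big_nth 0) big_mkord.
Qed.

Lemma card_disjoint_union :
  #|{: {i : 'I_(size s) & 'I_(nth 0 s i)}}| = sumn s.
Proof.
rewrite card_tagged sumnE big_map big_enum /= sumnE (big_nth 0) big_mkord.
by apply: eq_bigr => i _; rewrite card_ord.
Qed.
End DisjointUnion.

(** * Decomposition of a graph into unions of components *)

Section Decomposition.
Variables (V : finType) (H : sgraph V) (G : forall m, sgraph 'I_m).
Variables (x0 : V) (ss : seq (seq V)).
Hypothesis ss_uniq : uniq (flatten ss).
Hypothesis ss_all : forall x, x \in flatten ss.
Hypothesis ss_closed : forall c x y, c \in ss -> x \in c -> adj H x y -> y \in c.
Hypothesis ss_adj : forall c m (i j : 'I_m), c \in ss -> size c = m ->
  adj H (nth x0 c i) (nth x0 c j) = adj (G m) i j.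

(** The map [g] reads off the entry of a list at a given index. Through [flatten_index] its
    injectivity is the absence of repetitions in [flatten ss]; bijectivity then follows by
    counting. *)
Lemma iso_disjoint_union : iso H (disjoint_union G (shape ss)).
Proof.
pose T (i : 'I_(size (shape ss))) : finType := 'I_(nth 0 (shape ss) i).
pose g (u : {i & T i}) := nth x0 (nth [::] ss (tag u)) (tagged u).
have lt_ss (i : 'I_(size (shape ss))) : i < size ss.
  by rewrite -[X in _ < X](size_map size).
have sizeE (i : 'I_(size (shape ss))) :
    size (nth [::] ss i) = nth 0 (shape ss) i.
  by rewrite (nth_map [::]).
have gE u : g u =
    nth x0 (flatten ss) (flatten_index (shape ss) (tag u) (tagged u)).
  by rewrite nth_flatten flatten_indexKl ?flatten_indexKr.
have inj_g : injective g.
  case=> i a [j b]; rewrite !gE /= => /eqP; rewrite nth_uniq //; last 2 first.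
  - by rewrite size_flatten flatten_indexP.
  - by rewrite size_flatten flatten_indexP.
  move/eqP => eq_ij; have ij : i = j.
    apply/val_inj; rewrite /= -(flatten_indexKl (ltn_ord a)) eq_ij.
    by rewrite flatten_indexKl.
  case: j / ij b eq_ij => b eq_ab; congr (Tagged T _).
  apply/val_inj; rewrite /= -(flatten_indexKr (ltn_ord a)) eq_ab.
  by rewrite flatten_indexKr.
have bij_g : bijective g.
  apply: inj_card_bij inj_g _; rewrite card_disjoint_union -size_flatten.
  by rewrite -(card_uniqP ss_uniq) subset_leq_card //; apply/subsetP => x _.
apply: iso_sym; exists g; split=> // -[i a] [j b].
have c_ss : nth [::] ss i \in ss by rewrite mem_nth.
apply/idP/idP => [uv|].
  have ij : i = j := adj_disjoint_union_tag uv.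
  case: j / ij b uv => b; rewrite adj_disjoint_union => ab.
  by rewrite /g /= (ss_adj _ _ c_ss (sizeE i)).
(* Closedness puts the second endpoint in the [i]-th list too, and injectivity of [g] then forces
   [i = j]. *)
move=> ab; have /(nthP x0)[b' lt_b' eq_b] : g (Tagged T b) \in nth [::] ss i.
  by apply: ss_closed ab; rewrite // /g mem_nth //= sizeE.
rewrite sizeE in lt_b'.
have bE : Tagged T b = Tagged T (Ordinal lt_b' : T i).
  by apply: inj_g; rewrite -eq_b.
have ij : i = j := esym (congr1 tag bE).
case: j / ij b ab {eq_b bE} => b ab.
by rewrite adj_disjoint_union -(ss_adj _ _ c_ss (sizeE i)).
Qed.

End Decomposition.

(** Such a collection is a union of connected components. A general [predType] serves sets and lists
    alike. *)
Definition nbr_closed (V : finType) (H : sgraph V) (pT : predType V) (A : pT) :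
    Prop :=
  forall x y, x \in A -> adj H x y -> y \in A.

(** Peel off one closed list at a time: by symmetry of adjacency, what remains of a closed set is
    closed again, and it is smaller because the list is nonempty. *)
Lemma decompose (V : finType) (H : sgraph V) (P : seq V -> Prop) :
  (forall (A : {set V}) x, nbr_closed H A -> x \in A ->
     exists c : seq V, [/\ 0 < size c, uniq c, {subset c <= A},
      nbr_closed H c & P c]) ->
  exists ss, [/\ uniq (flatten ss), forall x, x \in flatten ss,
    forall c : seq V, c \in ss -> nbr_closed H c
      & forall c : seq V, c \in ss -> P c].
Proof.
move=> step; suff decA (m : nat) (A : {set V}) : #|A| <= m -> nbr_closed H A ->
    exists ss, [/\ uniq (flatten ss), flatten ss =i A,
      forall c : seq V, c \in ss -> nbr_closed H c
      & forall c : seq V, c \in ss -> P c].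
  have [|ss [ss_uniq ssV ss_closed ssP]] := decA _ [set: V] (leqnn _).
    by move=> x y _ _; rewrite inE.
  by exists ss; split=> // x; rewrite ssV inE.
elim: m A => [|m IHm] A.
  rewrite leqn0 cards_eq0 => /eqP-> _; exists [::].
  by split=> // x; rewrite inE.
move=> leA A_closed; have [->|/set0Pn[x xA]] := eqVneq A set0.
  by exists [::]; split=> // x; rewrite inE.
have [c [c_gt0 c_uniq cA c_closed Pc]] := step A x A_closed xA.
have [||ss [ss_uniq ssA ss_closed ssP]] := IHm [set y in A | y \notin c].
- rewrite -ltnS; apply: leq_trans leA; apply/proper_card/properP.
  split; first by apply/subsetP => y; rewrite inE => /andP[].
  have hc : head x c \in c by case: (c) c_gt0 => //= y p _; apply: mem_head.
  by exists (head x c); rewrite ?cA // inE hc andbF.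
- move=> y z; rewrite !inE => /andP[yA yc] yz.
  rewrite (A_closed y z yA yz); apply: contra yc => zc.
  by apply: c_closed zc _; rewrite adjC.
exists (c :: ss); split.
- rewrite /= cat_uniq c_uniq ss_uniq andbT; apply/hasPn => y.
  by rewrite ssA inE => /andP[].
- move=> y; rewrite /= mem_cat ssA inE; case: (boolP (y \in c)) => [/cA->//|_].
  by rewrite andbT.
- by move=> d; rewrite inE => /predU1P[->|/ss_closed].
- by move=> d; rewrite inE => /predU1P[->|/ssP].
Qed.

(** With degrees at most 1, every component is an edge or an isolated vertex. The edge count gives
    [n./2] pairs, so the number of isolated vertices is the parity of [n]. *)
Lemma matching_iso (n : nat) (H : sgraph 'I_n) :
  0 < n -> (forall x, deg H x <= 1) -> #|edges H| = n./2 ->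
  iso H (disjoint_union complete_graph (nseq n./2 2 ++ nseq (odd n) 1)).
Proof.
move=> n_gt0 degH edgesH; pose x0 := Ordinal n_gt0.
have nbr_uniq x y z : adj H x y -> adj H x z -> y = z.
  by move=> xy xz; apply: (card_le1_eqP (degH x)).
pose P (c : seq 'I_n) := size c = 1 \/ exists x y, adj H x y /\ c = [:: x; y].
have [A x A_closed xA|ss [ss_uniq ssV ss_closed ssP]] := @decompose _ H P.
  case: (pickP (adj H x)) => [y xy|x_isol].
    exists [:: x; y]; split=> //; last by right; exists x, y.
    - by rewrite /= inE (adj_neq xy).
    - by move=> z; rewrite !inE => /orP[]/eqP-> //; apply: A_closed xy.
    - move=> z w; rewrite !inE => /orP[]/eqP-> zw.
        by rewrite (nbr_uniq _ _ _ xy zw) eqxx orbT.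
      by rewrite adjC in xy; rewrite (nbr_uniq _ _ _ xy zw) eqxx.
  exists [:: x]; split=> //; last by left.
  - by move=> z; rewrite inE => /eqP->.
  - by move=> z w; rewrite inE => /eqP->; rewrite x_isol.
(* The pairs are moved to the front so that the shape of the decomposition is literally the
   prescribed list of sizes. *)
pose two := filter (fun c : seq 'I_n => size c == 2) ss.
pose one := filter (predC (fun c : seq 'I_n => size c == 2)) ss.
have perm_ss : perm_eq (two ++ one) ss by apply/permPl/perm_filterC.
have mem_ss c : (c \in two ++ one) = (c \in ss) by rewrite (perm_mem perm_ss).
have shapeE : shape (two ++ one) = nseq (size two) 2 ++ nseq (size one) 1.
  rewrite /shape map_cat; congr (_ ++ _);
  rewrite -(size_map size); apply/all_pred1P/allP => _ /mapP[c + ->]; rewrite mem_filter /=; case/andP=> // + /ssP.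
  by move=> sz; case=> [->//|[x [y [_ cE]]]]; rewrite cE in sz.
have perm_fl := perm_flatten perm_ss.
have isoH : iso H (disjoint_union complete_graph (shape (two ++ one))).
  apply: (iso_disjoint_union (x0 := x0)).
  - by rewrite (perm_uniq perm_fl).
  - by move=> x; rewrite (perm_mem perm_fl).
  - by move=> c x y; rewrite mem_ss => /ss_closed; apply.
  - move=> c m i j; rewrite mem_ss adj_graph_of_rel andbT => /ssP cP sz.
    have [<-|neq_ij] := eqVneq i j; first by rewrite adjxx.
    case: cP sz i j neq_ij => [->|[x [y [xy ->]]]] /= <-.
      by move=> i j; rewrite !ord1 eqxx.
    by move=> [[|[|i]] lti] [[|[|j]] ltj] //= _; rewrite adjC.
have sz_n : 2 * size two + size one = n.
  transitivity (sumn (shape (two ++ one))).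
    by rewrite shapeE sumn_cat !sumn_nseq mul1n.
  rewrite -size_flatten (perm_size perm_fl) -(card_uniqP ss_uniq).
  rewrite -[RHS]card_ord.
  by apply: eq_card => x; rewrite ssV.
have edges_two : #|edges H| = size two.
  apply/eqP; rewrite -(eqn_pmul2l (ltn0Sn 1)) (iso_edges isoH) shapeE.
  rewrite (@edges_disjoint_union _ _ predn) => [|m x].
    by rewrite big_cat /= !big_nseq !iter_addn; lia.
  exact: deg_complete.
rewrite edgesH in edges_two; rewrite shapeE -edges_two in isoH.
have -> : nat_of_bool (odd n) = size one by lia.
exact: isoH.
Qed.

(* Extending a path at its head must stop; a second neighbour of the head then
   closes a cycle. *)
Lemma exists_cycle (V : finType) (H : sgraph V) (A : {set V}) (x0 : V) :
  x0 \in A -> nbr_closed H A -> {in A, forall x, 1 < deg H x} ->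
  exists c : seq V, [/\ 2 < size c, uniq c, cycle (adj H) c & {subset c <= A}].
Proof.
move=> x0A A_closed degA.
(* A path with [m.+1] vertices for [m = #|V|] would be too long, so the first alternative must
   occur. *)
suff ext m : (exists c : seq V,
      [/\ 2 < size c, uniq c, cycle (adj H) c & {subset c <= A}]) \/
    (exists x p, [/\ size p = m, uniq (x :: p), path (adj H) x p
      & {subset x :: p <= A}]).
  have [//|[x [p [size_p /card_uniqP + _ _]]]] := ext #|V|.
  rewrite /= size_p => cardV; have := max_card (mem (x :: p)).
  by rewrite cardV ltnn.
elim: m => [|m [|[x [p [size_p p_uniq xp pA]]]]]; [right|by left|].
  by exists x0, [::]; split=> // x; rewrite inE => /eqP->.
have xA : x \in A by rewrite pA ?mem_head.
case: (pickP (fun z => adj H x z && (z \notin x :: p))) => [z /andP[xz zp]|nbr_p].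
  right; exists z, (x :: p); split; rewrite /= ?size_p //.
  - by rewrite zp.
  - by rewrite adjC xz.
  - by move=> y; rewrite inE => /predU1P[->|/pA//]; apply: A_closed xz.
left; have in_p z : adj H x z -> z \in p.
  move=> xz; have := nbr_p z; rewrite xz inE negb_or.
  by rewrite eq_sym (adj_neq xz) /= => /negbFE.
have /card_gt1P[a [b [xa xb neq_ab]]] := degA x xA.
(* At most one of [a], [b] is the first vertex of [p]; the other lies further along, so the cycle it
   closes has length at least 3. *)
have {a b xa xb neq_ab} [z xz zp] : exists2 z, adj H x z & z \in behead p.
  case: p {size_p p_uniq xp pA nbr_p} in_p => [|y p] in_p; first by have := in_p a xa.
  have := in_p a xa; have := in_p b xb; rewrite !inE => /orP[/eqP bE|bp _].
    by move=> /orP[/eqP aE|ap]; [rewrite aE bE eqxx in neq_ab|exists a].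
  by exists b.
case: p zp size_p p_uniq xp pA {nbr_p in_p} => // y p /= /splitPr[p1 p2] _.
rewrite -cat_rcons => p_uniq xp pA; exists (x :: y :: rcons p1 z); split.
- by rewrite /= size_rcons.
- have : uniq ((x :: y :: rcons p1 z) ++ p2) := p_uniq.
  by rewrite cat_uniq => /andP[].
- rewrite /= rcons_path last_rcons (adjC H z) xz andbT.
  by move: xp; rewrite cat_path => /and3P[-> ->].
- by move=> w wc; apply: pA; rewrite -!cat_cons mem_cat wc.
Qed.

(** Turns [next] into index arithmetic modulo the length, the form in which [ordS] is given. *)
Lemma next_nth_mod (T : eqType) (x0 : T) (c : seq T) (i : nat) :
  uniq c -> i < size c -> next c (nth x0 c i) = nth x0 c (i.+1 %% size c).
Proof.
move=> c_uniq lt_i; rewrite next_nth mem_nth // index_uniq //.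
case: c lt_i {c_uniq} => // y p /=; rewrite ltnS leq_eqVlt => /predU1P[->|lt_i].
  (* At the last index, [next] reads past the tail and gets the default, which is the head: this is
     the wrap-around. *)
  by rewrite modnn nth_default.
by rewrite modn_small //; apply: set_nth_default.
Qed.

(** The successor and the predecessor are two distinct neighbours, so degree 2 leaves room for no
    other: the cycle has no chord and no edge leaving it. *)
Lemma adj_cycle_nbr (V : finType) (H : sgraph V) (c : seq V) :
  2 < size c -> uniq c -> cycle (adj H) c -> {in c, forall x, deg H x = 2} ->
  {in c, forall x y, adj H x y = (y == next c x) || (y == prev c x)}.
Proof.
move=> c_gt2 c_uniq c_cycle degc x xc y.
have neq_np : next c x != prev c x.
  apply/eqP => eq_np; have := prev_next c_uniq (prev c x).
  rewrite (next_prev c_uniq) -eq_np => prev_x.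
  (* Two steps forward would return to [x], that is, [i + 2] and [i] would agree modulo a length
     greater than 2. *)
  have : next c (next c x) = x by rewrite eq_np next_prev.
  case/(nthP x): xc {eq_np prev_x} => i lt_i <-.
  rewrite !next_nth_mod ?ltn_mod //; last by lia.
  move/eqP; rewrite nth_uniq ?ltn_mod //; try by lia.
  have [lt_i1|ge_i1] := ltnP i.+1 (size c).
    rewrite (modn_small lt_i1); have [lt_i2|ge_i2] := ltnP i.+2 (size c).
      by rewrite modn_small //; lia.
    have -> : i.+2 = size c by apply/eqP; rewrite eqn_leq lt_i1.
    by rewrite modnn; lia.
  have iE : i.+1 = size c by apply/eqP; rewrite eqn_leq lt_i.
  by rewrite iE modnn modn_small; lia.
have sub : [set next c x; prev c x] \subset adj H x.
  apply/subsetP => z; rewrite !inE => /orP[]/eqP->; rewrite in_adj.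
    exact: next_cycle c_cycle xc.
  by rewrite adjC; apply: prev_cycle c_cycle xc.
have eq_nbr : [set next c x; prev c x] =i adj H x.
  apply/subset_cardP => //; rewrite cards2 neq_np.
  exact/esym/degc.
by rewrite -in_adj -eq_nbr !inE.
Qed.

Lemma adj_cycle_graph (m : nat) (i j : 'I_m) :
  2 < m -> adj (cycle_graph m) i j = (j == ordS i) || (i == ordS j).
Proof.
move=> m_gt2; rewrite adj_graph_of_rel; have [<-|//] := eqVneq i j.
suff /negbTE-> : i != ordS i by [].
apply/eqP => /(congr1 val) /=; have [lt_i|ge_i] := ltnP i.+1 m.
  by rewrite modn_small //; lia.
have -> : i.+1 = m by have := ltn_ord i; lia.
by rewrite modnn; have := ltn_ord i; lia.
Qed.

(** Any cycle found inside a closed set uses up the degrees of its vertices, hence is itself closed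
    and can be peeled off by [decompose]. *)
Lemma regular2_iso (V : finType) (H : sgraph V) (x0 : V) :
  (forall x, deg H x = 2) ->
  exists s, all (leq 3) s /\ iso H (disjoint_union cycle_graph s).
Proof.
move=> degH.
pose P (c : seq V) := [/\ 2 < size c, uniq c & cycle (adj H) c].
have nbrP (c : seq V) x y : P c -> x \in c ->
    adj H x y = (y == next c x) || (y == prev c x).
  by case=> c_gt2 c_uniq c_cycle xc; apply: (adj_cycle_nbr c_gt2).
have [A x A_closed xA|ss [ss_uniq ssV ss_closed ssP]] := @decompose _ H P.
  have [|c [c_gt2 c_uniq c_cycle cA]] := exists_cycle xA A_closed.
    by move=> y _; rewrite degH.
  have Pc : P c by [].
  exists c; split=> //; first by lia.
  move=> y z yc; rewrite (nbrP c) // => /orP[]/eqP->.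
    by rewrite mem_next.
  by rewrite mem_prev.
exists (shape ss); split.
  by apply/allP => _ /mapP[c /ssP[c_gt2 _ _] ->].
apply: (iso_disjoint_union (x0 := x0)) => // [c y z /ss_closed|c m i j c_ss sz].
  exact.
have Pc := ssP c c_ss; have [c_gt2 c_uniq _] := Pc.
case: m / sz i j => i j; rewrite (nbrP c) ?mem_nth // adj_cycle_graph //.
have eq_next k l : k < size c -> l < size c ->
    (nth x0 c l == next c (nth x0 c k)) = (l == k.+1 %% size c).
  move=> lt_k lt_l; rewrite next_nth_mod // nth_uniq // ltn_mod; lia.
(* Being a predecessor is restated as being a successor with the ends exchanged, as in
   [adj_cycle_graph]. *)
have -> : (nth x0 c j == prev c (nth x0 c i)) = (nth x0 c i == next c (nth x0 c j)).
  by rewrite -(can2_eq (next_prev c_uniq) (prev_next c_uniq)) eq_sym.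
by rewrite !eq_next.
Qed.

(** * The extremal graphs *)

Lemma deg_cycle (m : nat) (i : 'I_m) : 2 < m -> deg (cycle_graph m) i = 2.
Proof.
move=> m_gt2; have neq_i : ordS i != ord_pred i.
  apply/eqP => /(congr1 val) /=; have := ltn_ord i.
  have [lt_i _|ge_i lt_i] := ltnP i.+1 m.
    (* [ord_pred i] is [(i + m).-1 %% m], so the value 0 of [i] is treated apart. *)
    rewrite modn_small //; case: (val i) lt_i => [|j] lt_j.
      by rewrite add0n modn_small; lia.
    by rewrite addSn /= modnDr modn_small; lia.
  have iE : i.+1 = m by apply/eqP; rewrite eqn_leq lt_i.
  rewrite iE modnn; case: (val i) iE => [|j] jE; first by lia.
  by rewrite addSn /= modnDr modn_small; lia.
have := cards2 (ordS i) (ord_pred i); rewrite neq_i => <-.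
apply: eq_card => j; rewrite in_adj adj_cycle_graph // !inE; congr (_ || _).
by rewrite -(can2_eq (@ordSK m) (@ord_predK m)) eq_sym.
Qed.

(** The claimed value within [nat]. For [k >= 4] it is the number of edges of the complete split
    graph, half of its degree sum. *)
Definition star_ot (n k : nat) : nat :=
  if k <= 3 then ((k - 1) * n)./2 else ((k - 2) * (2 * n - k + 1))./2.

Definition star_extremal (n k : nat) (H : sgraph 'I_n) : Prop :=
  [\/ k = 1 /\ iso H (empty_graph n),
      k = 2 /\ iso H (disjoint_union complete_graph
                        (nseq n./2 2 ++ nseq (odd n) 1)),
      k = 3 /\ (exists s : seq nat,
                  all (leq 3) s /\ iso H (disjoint_union cycle_graph s))
    | 4 <= k /\ complete_split (k - 2) (n - k + 2) H].

Lemma complete_split_iso (p q : nat) (V W : finType) (G : sgraph V)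
    (H : sgraph W) :
  iso G H -> complete_split p q H -> complete_split p q G.
Proof.
case=> f [bij_f adjf] [X [Y [[XY disj] [cX cY] adjX adjY adjXY]]].
exists (f @^-1: X), (f @^-1: Y).
have inj_f := bij_inj bij_f.
split.
- split; first by rewrite -preimsetU XY preimsetT.
  move: disj; rewrite -!setI_eq0 -preimsetI => /eqP->.
  by rewrite preimset0.
- by rewrite !(on_card_preimset (onW_bij _ bij_f)).
- by move=> x y; rewrite !inE adjf => xX yX neq_xy; rewrite adjX ?(inj_eq inj_f).
- by move=> x y; rewrite !inE adjf => xY yY; apply: adjY.
- by move=> x y; rewrite !inE adjf => xX yY; apply: adjXY.
Qed.

(** The degrees suffice both for counting edges and for excluding stars. *)
Lemma complete_split_deg (n p q : nat) (H : sgraph 'I_n) :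
  complete_split p q H ->
  exists2 X : {set 'I_n}, #|X| = p
    & forall x, deg H x = if x \in X then n.-1 else p.
Proof.
case=> X [Y [[XY disj] [cX _] adjX adjY adjXY]]; exists X => // x.
have YE y : (y \in Y) = (y \notin X).
  apply/idP/idP => [yY|yX]; first by rewrite (disjointFl disj).
  by have := in_setT y; rewrite -XY inE (negbTE yX).
have [xX|xX] := ifPn.
  rewrite -(deg_coloring (coloring_compl H) x) -[LHS]addn0; congr (_ + _).
  apply/esym/eq_card0 => y; rewrite in_adj adj_graph_of_rel (adjC H y) orbb inE.
  have [//|neq_xy] := eqVneq x y.
  by have [yX|yX] := boolP (y \in X); [rewrite adjX|rewrite adjXY ?YE].
rewrite -cX; apply: eq_card => y; rewrite in_adj.
have [yX|yX] := boolP (y \in X); first by rewrite adjC adjXY ?YE.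
by apply/negbTE/adjY; rewrite YE.
Qed.

Lemma star_extremal_iso (n k : nat) (H H' : sgraph 'I_n) :
  iso H H' -> star_extremal k H -> star_extremal k H'.
Proof.
move=> /iso_sym isoH [[k1 isoK]|[k2 isoK]|[k3 [s [s3 isoK]]]|[k4 splitH]].
- by constructor 1; split=> //; apply: iso_trans isoK.
- by constructor 2; split=> //; apply: iso_trans isoK.
- by constructor 3; split=> //; exists s; split=> //; apply: iso_trans isoK.
- by constructor 4; split=> //; apply: complete_split_iso splitH.
Qed.

Lemma regular2_disjoint_union (V : finType) (H : sgraph V) (s : seq nat) :
  all (leq 3) s -> iso H (disjoint_union cycle_graph s) -> forall x, deg H x = 2.
Proof.
move=> s3 [f [bij_f adjf]] x; rewrite (iso_deg bij_f adjf) deg_disjoint_union.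
by rewrite deg_cycle // (allP s3) // mem_nth.
Qed.

Lemma star_extremal_deg (n k : nat) (H : sgraph 'I_n) :
  k <= 3 -> star_extremal k H -> forall x, deg H x < k.
Proof.
move=> k3 [[-> isoK]|[-> isoK]|[-> [s [s3 isoK]]]|[k4 _]] x; last by lia.
- case: isoK => f [bij_f adjf]; rewrite ltnS leqn0; apply/eqP/eq_card0 => y.
  by rewrite in_adj adjf adj_graph_of_rel andbF.
- case: isoK => f [bij_f adjf]; rewrite (iso_deg bij_f adjf) deg_disjoint_union.
  rewrite deg_complete; case: (f x) => i /= _.
  have /(mem_nth 0) := ltn_ord i.
  by rewrite mem_cat !mem_nseq => /orP[]/andP[_ /eqP->].
- by rewrite (regular2_disjoint_union s3 isoK).
Qed.

(** The two factors have opposite parity, so the halving in [star_ot] is exact. *)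
Lemma star_ot_double (n k : nat) : 4 * k <= n -> 4 <= k ->
  2 * star_ot n k = (k - 2) * (2 * n - k + 1).
Proof.
move=> le_n k4; rewrite /star_ot leqNgt k4 /=.
have : odd ((k - 2) * (2 * n - k + 1)) = false by rewrite oddM; lia.
by set N := _ * _; lia.
Qed.

Lemma star_extremal_edges (n k : nat) (H : sgraph 'I_n) :
  4 * k <= n -> star_extremal k H -> #|edges H| = star_ot n k.
Proof.
move=> le_n extH; apply/eqP; rewrite -(eqn_pmul2l (ltn0Sn 1)); apply/eqP.
case: (extH) => [[k1 isoK]|[k2 isoK]|[k3 [s [s3 isoK]]]|[k4 /complete_split_deg]].
- rewrite -handshake k1 big1 ?muln0 // => x _.
  by have := star_extremal_deg _ extH x; rewrite k1 => /(_ isT); case: deg.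
- rewrite (iso_edges isoK) (@edges_disjoint_union _ _ predn); last exact: deg_complete.
  by rewrite big_cat /= !big_nseq !iter_addn k2 /star_ot /= mul1n; lia.
- rewrite -handshake (eq_bigr _ (fun x _ => regular2_disjoint_union s3 isoK x)).
  by rewrite sum_nat_const card_ord k3 /star_ot /=; lia.
case=> X cX degH; rewrite star_ot_double //.
have [|y|_ eq_e] := @sum_deg_leqif n n.-1 (k - 2) H X.
- by move=> x xX; rewrite degH xX.
- by rewrite inE => yX; rewrite degH (negbTE yX).
have /eqP-> : 2 * #|edges H| == #|X| * n.-1 + #|~: X| * (k - 2).
  by rewrite eq_e; apply/forallP => x; rewrite degH.
have cY : #|~: X| = n - (k - 2) by have := cardsC X; rewrite card_ord; lia.
(* With [#|X|] and the degree off [X] both equal to [k - 2], the two defect terms vanish. *)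
have := @split_edges_id n (k - 2) (k - 2) (k - 2).
by rewrite cY cX subnn muln0 mul0n !addn0 => -> //; [congr (_ * _)|]; lia.
Qed.

Lemma star_extremal_ex (n k : nat) : 0 < n -> 0 < k -> 4 * k <= n ->
  exists H : sgraph 'I_n, star_extremal k H.
Proof.
move=> n_gt0 k_gt0 le_n; have [k4|k_le3] := leqP 4 k; last first.
  case: k k_gt0 le_n k_le3 => [|[|[|[|]]]] // _ le_n _.
  - exists (empty_graph n); constructor 1; split=> //.
    by exists id; split=> //; exists id.
  - have [|H isoH] := @iso_ord _ (disjoint_union complete_graph
        (nseq n./2 2 ++ nseq (odd n) 1)) n.
      by rewrite card_disjoint_union sumn_cat !sumn_nseq mul1n; lia.
    by exists H; constructor 2.
  - have [|H isoH] := @iso_ord _ (disjoint_union cycle_graph [:: n]) n.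
      by rewrite card_disjoint_union /= addn0.
    exists H; constructor 3; split=> //; exists [:: n].
    by rewrite /= andbT; split=> //; lia.
pose X := [set i : 'I_n | i < k - 2].
have cX : #|X| = k - 2.
  have le_kn : k - 2 <= n by lia.
  have inj_w : injective (widen_ord le_kn).
    by move=> i j /(congr1 val) /= /val_inj.
  rewrite -[RHS]card_ord -(card_imset _ inj_w).
  apply: eq_card => i; rewrite inE; apply/idP/imsetP => [lt_i|[j _ ->] //=].
  by exists (Ordinal lt_i) => //; apply: val_inj.
(* Since [graph_of_rel] symmetrises, the edges are exactly the pairs that meet [X]. *)
exists (graph_of_rel (fun i _ => i \in X)); constructor 4; split=> //.
exists X, (~: X); split.
- by split; [rewrite setUCr | rewrite -subsets_disjoint].
- by split=> //; rewrite cardsCs setCK card_ord cX; lia.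
- by move=> x y xX _ neq_xy; rewrite adj_graph_of_rel neq_xy xX.
- by move=> x y; rewrite !in_setC adj_graph_of_rel => /negbTE-> /negbTE->; rewrite andbF.
- move=> x y xX; rewrite in_setC adj_graph_of_rel xX andbT => yX.
  by apply: contraNneq yX => <-.
Qed.

(** * Missing colour patterns and the resulting edge bounds *)

Lemma star_extremal_no_copy (n k : nat) (R B : sgraph 'I_n) :
  0 < k -> two_coloring R B -> star_extremal k R ->
  exists r b : nat, r + b = #|edges (star k)| /\ ~ colored_copy (star k) R B r b.
Proof.
move=> k_gt0 RB extR; rewrite card_edges_star; have [k4|k_le3] := leqP 4 k; last first.
  (* The missing pattern is the all-red star: red degrees are below [k]. *)
  exists k, 0; rewrite addn0; split=> // copyR.
  have [|v [le_k _]] := (colored_starP k 0 RB).1; first by rewrite addn0.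
  by have := star_extremal_deg k_le3 extR v; rewrite ltnNge le_k.
have k1E : k - 1 + 1 = k by lia.
(* In a red split graph, vertices of the clique have no blue edge and all others have only [k - 2]
   red ones. *)
exists (k - 1), 1; split=> // copyR.
have [|v [le_R le_B]] := (colored_starP (k - 1) 1 RB).1; first by rewrite k1E.
case: extR => [[? _]|[? _]|[? _]|[_ /complete_split_deg[X _ degR]]]; try by lia.
have := deg_coloring RB v; move: le_R; rewrite degR; case: ifP => _; lia.
Qed.

(** For [b > 0] this is [split_extremal]; for [b = 0] the set [X] is empty and only a bound on red
    degrees remains. Which bound dominates depends on [k], and the other one never reaches
    [star_ot n k]. *)
Lemma star_free_edges (n k r b : nat) (R B : sgraph 'I_n) (X : {set 'I_n}) :
  0 < k -> 4 * k <= n -> two_coloring R B -> r + b = k -> #|X| <= #|~: X| ->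
  {in X, forall x, deg B x < b} -> {in ~: X, forall y, deg R y < r} ->
  #|edges R| <= star_ot n k /\
  (#|edges R| = star_ot n k -> star_extremal k R).
Proof.
move=> k_gt0 le_n RB rbk le_XY degB degR; have [b0|b_gt0] := posnP b; last first.
  have [k_ge2 le_e eq_e] := split_extremal RB rbk le_n b_gt0 le_XY degB degR.
  have [k4|k_le3] := leqP 4 k.
    have dbl := star_ot_double le_n k4; rewrite -dbl in le_e eq_e; split; first by lia.
    by move=> eE; constructor 4; split=> //; apply: eq_e; rewrite eE.
  (* For [k = 2] and [k = 3] the split bound stays strictly below [star_ot n k], so the equality
     case is void. *)
  case: k k_gt0 le_n k_le3 k_ge2 le_e {eq_e rbk} => [|[|[|[|]]]] // _ le_n _ _;
  by rewrite /star_ot /=; lia.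
have degRk x : deg R x < k.
  rewrite -rbk b0 addn0; apply: degR; rewrite inE; apply/negP => /degB.
  by rewrite b0.
have le_e : 2 * #|edges R| <= n * k.-1.
  rewrite -handshake -[n in leqRHS]card_ord -sum_nat_const; apply: leq_sum => x _.
  by rewrite -ltnS prednK.
have [k4|k_le3] := leqP 4 k.
  have dbl := star_ot_double le_n k4.
  have lt_e : n * k.-1 < 2 * star_ot n k.
    (* After substituting [k = j + 4] and [n = 4 * k + m], the difference of the two sides is a
       polynomial with positive coefficients. *)
    rewrite dbl; have [j kE] : exists j, k = j + 4 by exists (k - 4); lia.
    have [m nE] : exists m, n = 4 * k + m by exists (n - 4 * k); lia.
    have -> : k - 2 = j + 2 by lia.
    have -> : 2 * n - k + 1 = 7 * j + 29 + 2 * m by lia.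
    have -> : k.-1 = j + 3 by lia.
    have -> : n = 4 * j + 16 + m by lia.
    have -> : (j + 2) * (7 * j + 29 + 2 * m) =
        (4 * j + 16 + m) * (j + 3) + (3 * j * j + 15 * j + j * m + m + 9).+1.
      by nia.
    by rewrite -[ltnLHS]addn0 ltn_add2l.
  by split; [lia|move=> eE; exfalso; lia].
case: k k_gt0 le_n k_le3 degRk le_e {rbk} => [|[|[|[|]]]] // _ le_n _ degRk le_e.
- split=> [|_]; first by move: le_e; rewrite /star_ot /=; lia.
  constructor 1; split=> //; exists id; split; first by exists id.
  move=> x y; rewrite adj_graph_of_rel andbF; apply/negbTE/negP => xy.
  have /card0_eq/(_ y) : deg R x = 0 by case: deg (degRk x).
  by rewrite in_adj xy.
- split=> [|eE]; first by move: le_e; rewrite /star_ot /=; lia.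
  constructor 2; split=> //; apply: matching_iso => //; first by lia.
  by rewrite eE /star_ot /= mul1n.
- split=> [|eE]; first by move: le_e; rewrite /star_ot /=; lia.
  have n_gt0 : 0 < n by lia.
  constructor 3; split=> //; apply: regular2_iso => [|x]; first exact: (Ordinal n_gt0).
  (* Having [n] edges is equality in the handshake bound with cap 2, so every degree is 2. *)
  have [|y|_ eq_e] := @sum_deg_leqif n 2 2 R setT.
  - by move=> y _; rewrite -ltnS.
  - by rewrite -ltnS.
  have : 2 * #|edges R| == #|[set: 'I_n]| * 2 + #|~: [set: 'I_n]| * 2.
    by rewrite setCT cards0 cardsT card_ord eE /star_ot /=; lia.
  by rewrite eq_e => /forallP/(_ x)/eqP; rewrite inE.
Qed.

(** Swapping the colours exchanges [r] with [b] and [X] with its complement; the smaller of these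
    two sets decides which colour gets the bound. *)
Lemma star_free_min (n k r b : nat) (R B : sgraph 'I_n) :
  0 < k -> 4 * k <= n -> two_coloring R B -> r + b = k ->
  ~ colored_copy (star k) R B r b ->
  (#|edges R| <= star_ot n k /\
   (#|edges R| = star_ot n k -> star_extremal k R)) \/
  (#|edges B| <= star_ot n k /\
   (#|edges B| = star_ot n k -> star_extremal k B)).
Proof.
move=> k_gt0 le_n RB rbk no_copy; pose X := [set v | deg B v < b].
have degB : {in X, forall x, deg B x < b} by move=> x; rewrite inE.
have degR : {in ~: X, forall y, deg R y < r}.
  move=> y; rewrite !inE -leqNgt => le_b; rewrite ltnNge; apply/negP => le_r.
  by apply: no_copy; rewrite -rbk; apply/(colored_starP r b RB); exists y.
have [le_XY|le_YX] := leqP #|X| #|~: X|; [left|right].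
  exact: star_free_edges k_gt0 le_n RB rbk le_XY degB degR.
have degB' : {in ~: ~: X, forall x, deg B x < b} by rewrite setCK.
apply: star_free_edges k_gt0 le_n (coloring_sym RB) _ _ degR degB'.
  by rewrite addnC.
by rewrite setCK ltnW.
Qed.

(** Ensures that when one colour has [star_ot n k] edges the other has more, so extremal graphs do
    occur as the smaller colour class. *)
Lemma star_ot_lt (n k : nat) (R B : sgraph 'I_n) :
  0 < k -> 4 * k <= n -> two_coloring R B ->
  2 * star_ot n k < #|edges R| + #|edges B|.
Proof.
move=> k_gt0 le_n RB; rewrite -(ltn_pmul2l (ltn0Sn 1)) (edges_coloring RB).
have [k4|k_le3] := leqP 4 k.
  rewrite star_ot_double // mulnA.
  have le_T : 2 * (k - 2) * (2 * n - k + 1) <= 2 * (k - 2) * (2 * n).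
    by rewrite leq_mul2l; apply/orP; right; lia.
  apply: leq_ltn_trans le_T _; rewrite mulnC -mulnA (mulnC 2) -mulnA ltn_pmul2l; lia.
have le_t : 2 * (2 * star_ot n k) <= n * (2 * (k - 1)).
  by rewrite /star_ot (_ : k <= 3) //; set N := (k - 1) * n; lia.
by apply: leq_ltn_trans le_t _; rewrite ltn_pmul2l; lia.
Qed.

(** * The value of [ot] and the family [Ot] for stars *)

Lemma ot_star (n k : nat) :
  0 < n -> 0 < k -> 4 * k <= n -> ot n (star k) = star_ot n k.
Proof.
move=> n_gt0 k_gt0 le_n; rewrite /ot; case: ex_minnP => s /asboolP omni_s min_s.
apply/eqP; rewrite eqn_leq; apply/andP; split.
  apply: min_s; apply/asboolP => R B RB; rewrite ltn_min => /andP[ltR ltB] r b.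
  rewrite card_edges_star => rbk; apply: contrapT => no_copy.
  by case: (star_free_min k_gt0 le_n RB rbk no_copy) => -[le_e _]; lia.
(* For smaller [s], an extremal graph and its complement would both exceed [s] edges while still
   missing a pattern. *)
rewrite leqNgt; apply/negP => lt_s.
have [H extH] := star_extremal_ex n_gt0 k_gt0 le_n.
have RB := coloring_compl H; have lt_e := star_ot_lt k_gt0 le_n RB.
have [r [b [rbk]]] := star_extremal_no_copy k_gt0 RB extH; apply.
apply: omni_s RB _ r b rbk; rewrite ltn_min.
by have := star_extremal_edges le_n extH; lia.
Qed.

(** Both colours have at least [star_ot n k] edges here, so the upper bound of [star_free_min] is
    attained. *)
Lemma star_free_extremal (n k : nat) (R B : sgraph 'I_n) :
  0 < k -> 4 * k <= n -> two_coloring R B ->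
  minn #|edges R| #|edges B| = star_ot n k ->
  (exists r b : nat, r + b = #|edges (star k)| /\
     ~ colored_copy (star k) R B r b) <->
  star_extremal k R \/ star_extremal k B.
Proof.
move=> k_gt0 le_n RB min_e; split=> [[r [b []]]|[extR|extB]].
- rewrite card_edges_star => rbk /(star_free_min k_gt0 le_n RB rbk).
  by case=> -[le_e ext]; [left|right]; apply: ext; lia.
- exact: star_extremal_no_copy k_gt0 RB extR.
have [r [b [rbk no_copy]]] := star_extremal_no_copy k_gt0 (coloring_sym RB) extB.
exists b, r; split; first by rewrite addnC.
by move/colored_copyC.
Qed.

(** The conditions of [is_Ot] determine the family: colour a given graph red and its complement
    blue, and the alternatives about the complement fail because it has too many edges. *)
Lemma Ot_star (n k : nat) (F : sgraph 'I_n -> Prop) :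
  0 < n -> 0 < k -> 4 * k <= n ->
  is_Ot (star k) F <-> (forall H, F H <-> star_extremal k H).
Proof.
move=> n_gt0 k_gt0 le_n.
have iso_refl (G : sgraph 'I_n) : iso G G by exists id; split=> //; exists id.
split=> [[F_iso F_edges F_char]|F_ext]; last first.
  split=> [H H' isoH|H|R B RB].
  - by rewrite !F_ext; apply: star_extremal_iso.
  - by rewrite F_ext ot_star //; apply: star_extremal_edges.
  rewrite ot_star // => /(star_free_extremal k_gt0 le_n RB) ->; split.
    by case=> ext; [exists R|exists B]; rewrite F_ext; split; auto.
  case=> H [/F_ext extH] [] /iso_sym isoH; [left|right];
  exact: star_extremal_iso isoH extH.
move=> H; have RB := coloring_compl H; have lt_e := star_ot_lt k_gt0 le_n RB.
set Hc := graph_of_rel _ in RB lt_e.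
have min_e : #|edges H| = star_ot n k ->
    minn #|edges H| #|edges Hc| = star_ot n k by lia.
split=> [FH|extH].
  have eH := F_edges H FH; rewrite ot_star // in eH F_char F_edges.
  have : exists H', F H' /\ (iso H H' \/ iso Hc H') by exists H; auto.
  rewrite -(F_char _ _ RB (min_e eH)) (star_free_extremal k_gt0 le_n RB (min_e eH)).
  by case=> // /(star_extremal_edges le_n); lia.
have eH := star_extremal_edges le_n extH; rewrite ot_star // in F_char F_edges.
have : star_extremal k H \/ star_extremal k Hc by left.
rewrite -(star_free_extremal k_gt0 le_n RB (min_e eH)) (F_char _ _ RB (min_e eH)).
case=> H' [FH' [isoH|/iso_edges eq_e]].
  exact: F_iso (iso_sym isoH) FH'.
by have := F_edges _ FH'; lia.
Qed.

Lemma star_ot_rat (n k : nat) : 0 < k -> 4 * k <= n ->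
  ((star_ot n k)%:R =
     if (k <= 3)%N then (Num.floor ((k%:R - 1) / 2 * n%:R : rat))%:~R
     else (k%:R - 2) * n%:R - k%:R ^+ 2 / 2 + 3 / 2 * k%:R - 1 :> rat)%R.
Proof.
move=> k_gt0 le_n; have [k_le3|k4] := leqP k 3.
  have floorE : Num.floor ((k%:R - 1) / 2 * n%:R : rat)%R = Posz (star_ot n k).
    (* The remainder is 0 or 1, so half of the product lies between [star_ot n k] and its successor,
       the latter excluded. *)
    apply: floor_def; have tE : (k - 1) * n = 2 * star_ot n k + odd ((k - 1) * n).
      by rewrite /star_ot (_ : k <= 3) //; set N := (k - 1) * n; lia.
    have {tE} := congr1 (fun m => m%:R : rat)%R tE.
    rewrite natrD !natrM natrB // intrD -!pmulrn.
    by case: odd => /= tE; apply/andP; split; lra.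
  by rewrite floorE -pmulrn.
have := congr1 (fun m => m%:R : rat)%R (star_ot_double le_n k4).
rewrite !natrM natrD !natrB ?natrM; [|lia|lia].
by move=> tE; lra.
Qed.

Theorem theorem4p1 (n k : nat) (n_gt0 : 0 < n) (k_gt0 : 0 < k)
    (le_4k_n : 4 * k <= n) :
  ((ot n (star k))%:R =
     if (k <= 3)%N then (Num.floor ((k%:R - 1) / 2 * n%:R : rat))%:~R
     else (k%:R - 2) * n%:R - k%:R ^+ 2 / 2 + 3 / 2 * k%:R - 1 :> rat)%R
  /\
  (forall F : sgraph 'I_n -> Prop,
     is_Ot (star k) F <->
     (forall H : sgraph 'I_n,
        F H <->
        [\/ k = 1 /\ iso H (empty_graph n),
            k = 2 /\ iso H (disjoint_union complete_graph
                              (nseq n./2 2 ++ nseq (odd n) 1)),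
            k = 3 /\ (exists s : seq nat,
                        all (leq 3) s /\ iso H (disjoint_union cycle_graph s))
          | 4 <= k /\ complete_split (k - 2) (n - k + 2) H])).
Proof.
split=> [|F]; first by rewrite ot_star //; apply: star_ot_rat.
exact: Ot_star.
Qed.
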